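(* Let $E$ be a Polish space, let $c:E\times E\to[0,\infty)$ be a lower semicontinuous quasi-pseudo-metric, and let $g:E\to\mathbb{R}$ be Borel measurable. Assume that the function $$\mathcal{L}_{c,g}(E)\times\mathcal{L}_{c,g}(E)\ni (X,Y)\mapsto \mathrm{OT}_c(X,Y)+\mathrm{OT}_c(Y,X)$$ is a metric modulo equality in distribution (i.e. random variables with the same law are identified), and let $\gamma\in[0,1)$. Then $\le_{\gamma,g}$ is a partial order (reflexive, transitive and antisymmetric) on $\mathcal{L}_{c,g}(E)$ modulo equality in distribution; in particular, antisymmetry means that $X\le_{\gamma,g}Y$ and $Y\le_{\gamma,g}X$ imply $X\overset{d}{=}Y$.
   Context: A quasi-pseudo-metric on $E$ is a map $c:E\times E\to[0,\infty)$ with $c(x,x)=0$ for all $x\in E$ and $c(x,z)\le c(x,y)+c(y,z)$ for all $x,y,z\in E$. Lower semicontinuity of $c$ is with respect to the product topology on $E\times E$. For a Borel measurable $c:E\times E\to[0,\infty)$ and $E$-valued random variables $X,Y$, $\mathrm{OT}_c(X,Y):=\inf \mathbb{E}[c(\tilde X,\tilde Y)]$, where the infimum is over all couplings, i.e. all pairs $(\tilde X,\tilde Y)$ of $E$-valued random variables with $\tilde X\overset{d}{=}X$ and $\tilde Y\overset{d}{=}Y$ (equality in law). $\mathcal{L}_{c,g}(E)$ is the set of $E$-valued random variables $X$ for which there exists $x_0\in E$ with $\mathbb{E}[c(X,x_0)+c(x_0,X)+|g(X)|]<\infty$. For $X,Y\in\mathcal{L}_{c,g}(E)$ with $\mathbb{E}[g(X)]\le\mathbb{E}[g(Y)]$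 define $$\gamma^\ast(X,Y;g):=\frac{\mathrm{OT}_c(X,Y)}{\mathbb{E}[g(Y)]-\mathbb{E}[g(X)]+\mathrm{OT}_c(X,Y)},\qquad 0/0:=0.$$ For $\gamma\in[0,1]$ and $X,Y\in\mathcal{L}_{c,g}(E)$, write $X\le_{\gamma,g}Y$ if $\mathbb{E}[g(X)]\le\mathbb{E}[g(Y)]$ and $\gamma^\ast(X,Y;g)\le\gamma$. *)

(* Defs.v *)
From HB Require Import structures.
From mathcomp Require Import all_boot all_order all_algebra.
From mathcomp Require Import all_classical all_reals all_analysis.

Set Implicit Arguments.
Unset Strict Implicit.
Unset Printing Implicit Defensive.

Import Order.TTheory GRing.Theory Num.Theory.
Import numFieldNormedType.Exports.

Local Open Scope classical_set_scope.
Local Open Scope ring_scope.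

Section metric_notions.
Context {R : realType}.

(* The metric is existentially quantified: Polishness is a property of the
   topology. *)
Definition polish_space (E : topologicalType) : Prop :=
  (exists2 D : set E, countable D & dense D) /\
  exists d : E -> E -> R,
    [/\ forall x y, 0 <= d x y,
        forall x y, d x y = 0 <-> x = y,
        forall x y, d x y = d y x &
        forall x y z, d x z <= d x y + d y z] /\
    (forall (x : E) (U : set E),
      nbhs x U <-> exists2 e : R, 0 < e & [set y | d x y < e] `<=` U) /\
    (forall u : nat -> E,
      (forall e : R, 0 < e -> exists N : nat, forall m n : nat,
        (N <= m)%N -> (N <= n)%N -> d (u m) (u n) < e) ->
      exists l : E, u @ \oo --> l).

Definition quasi_pseudo_metric (E : Type) (c : E -> E -> R) : Prop :=
  [/\ forall x y, 0 <= c x y,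
      forall x, c x x = 0 &
      forall x y z, c x z <= c x y + c y z].

(* [d] induces a (finite) metric on the quotient of [S] by [eqv]. That [d] is
   compatible with [eqv] follows from symmetry, the triangle inequality and
   [d x y = 0 <-> eqv x y].
   [S] has type [T -> Prop] rather than [set T] because the type of all random
   variables below is too large for the universe of [set]. *)
Definition metric_modulo (T : Type) (S : T -> Prop) (eqv : T -> T -> Prop)
    (d : T -> T -> \bar R) : Prop :=
  [/\ forall x y, S x -> S y -> (0 <= d x y < +oo)%E,
      forall x y, S x -> S y -> (d x y = 0%E <-> eqv x y),
      forall x y, S x -> S y -> d x y = d y x &
      forall x y z, S x -> S y -> S z -> (d x z <= d x y + d y z)%E].

End metric_notions.

Definition partial_order_modulo (T : Type) (S : T -> Prop)
    (eqv r : T -> T -> Prop) : Prop :=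
  [/\ forall x x' y y', S x -> S x' -> S y -> S y' ->
        eqv x x' -> eqv y y' -> r x y -> r x' y',
      forall x, S x -> r x x,
      forall x y z, S x -> S y -> S z -> r x y -> r y z -> r x z &
      forall x y, S x -> S y -> r x y -> r y x -> eqv x y].

Definition borel (E : ptopologicalType) := g_sigma_algebraType (@open E).

Section optimal_transport.
Context {R : realType} {E : ptopologicalType}.

Record rvar := Rvar {
  rv_disp : measure_display;
  rv_space : measurableType rv_disp;
  rv_prob : probability rv_space R;
  rv_map : {RV rv_prob >-> borel E} }.

(* Restricted to Borel sets because [distribution] is unconstrained on
   non-measurable ones. *)
Definition same_law (X Y : rvar) : Prop :=
  forall A : set (borel E), measurable A ->
    distribution (rv_prob X) (rv_map X) A =
      distribution (rv_prob Y) (rv_map Y) A.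

Definition expect (f : E -> R) (X : rvar) : \bar R :=
  'E_(rv_prob X)[fun w => f (rv_map X w)]%E.

(* The two components of a coupling live on a common probability space, which
   is part of the coupling. *)
Definition OT (c : E -> E -> R) (X Y : rvar) : \bar R :=
  ereal_inf [set t | exists (d : measure_display) (W : measurableType d)
      (P : probability W R) (X' Y' : {RV P >-> borel E}),
    [/\ same_law (Rvar X') X, same_law (Rvar Y') Y &
        t = 'E_P[fun w => c (X' w) (Y' w)]%E]].

Definition Lcg (c : E -> E -> R) (g : E -> R) (X : rvar) : Prop :=
  exists x0 : E, (expect (fun x => c x x0 + c x0 x + `|g x|)%R X < +oo)%E.

(* On [Lcg c g] all the extended reals below are finite, so [fine] loses
   nothing; [x / 0 = 0] in [R] gives the convention 0/0 = 0. *)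
Definition gamma_star (c : E -> E -> R) (g : E -> R) (X Y : rvar) : R :=
  fine (OT c X Y) /
    (fine (expect g Y) - fine (expect g X) + fine (OT c X Y)).

Definition le_gamma (c : E -> E -> R) (g : E -> R) (gamma : R)
    (X Y : rvar) : Prop :=
  (expect g X <= expect g Y)%E /\ gamma_star c g X Y <= gamma.

End optimal_transport.

Arguments rvar R E : clear implicits.

(* Main.v *)
From HB Require Import structures.
Require Import Defs.
From mathcomp Require Import all_boot all_order all_algebra.
From mathcomp Require Import all_classical all_reals all_analysis.
From mathcomp Require Import measurable_realfun.
From mathcomp Require Import lra ring zify.

Import Order.TTheory GRing.Theory Num.Theory.
Import numFieldNormedType.Exports.

Local Open Scope classical_set_scope.
Local Open Scope ring_scope.

Set Implicit Arguments.
Unset Strict Implicit.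
Unset Printing Implicit Defensive.

(* Since gamma < 1, X <= Y means E g(X) <= E g(Y) and
   (1 - gamma) OT(X, Y) <= gamma (E g(Y) - E g(X)), a condition which adds up
   along chains as soon as OT satisfies the triangle inequality. The latter is a
   gluing argument. Given couplings (X, Y) on W1 and (Y', Z) on W2 with Y and Y'
   of the same law, Z is rebuilt on W1 x [0, 1]: a Polish space embeds into the
   extended line by a measurable map with a measurable left inverse, and the
   quantile transform of the conditional law of the code of Z given Y' (obtained
   from Radon-Nikodym densities), evaluated at Y and at the uniform second
   coordinate, has the same joint law with Y as the code of Z has with Y'. *)

(** * Bit sequences as extended reals *)

Section quaternary_code.
Context {R : realType}.
Implicit Types (b : nat -> bool) (t : \bar R).

(* A bit sequence is stored in the base-4 digits of a number: the digits being 0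
   or 1, the truncated tail is at most 1/3 of a unit in the last place, so that
   bits are recovered as parities of integer parts. *)
Fixpoint prefix_code b n : nat :=
  if n is m.+1 then (4 * prefix_code b m + b m)%N else 0.

Let approx b n : R := (prefix_code b n)%:R / 4 ^+ n.

(** The truncations increase, so their supremum is the value of the expansion; as an [esups] it
    inherits measurability from them. *)
Definition code b : \bar R := esups (EFin \o approx b) 0.

(** For [t >= 0], oddness of the integer part of [4 ^+ n.+1 * t]. This makes sense off the range of
    [code] too; [fine] sends the infinities to 0, outside the set. *)
Definition digit n : set (\bar R) := \bigcup_m
  [set t | ((m.*2.+1)%:R <= 4 ^+ n.+1 * fine t < (m.*2.+2)%:R)%R].

Lemma measurable_digit n : measurable (digit n).
Proof.
apply: bigcupT_measurable => m.
have mf : measurable_fun [set: \bar R] (fun t => 4 ^+ n.+1 * fine t)%R.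
  by apply: measurable_funM => //; exact: measurable_fine.
rewrite [X in measurable X](_ : _ = (fun t => 4 ^+ n.+1 * fine t)%R @^-1`
  `[(m.*2.+1)%:R, (m.*2.+2)%:R[); last first.
  by apply/seteqP; split => t /=; rewrite in_itv.
by rewrite -[_ @^-1` _]setTI; exact: mf.
Qed.

Let approxS b n : approx b n.+1 = approx b n + (b n)%:R / 4 ^+ n.+1.
Proof.
rewrite /approx /= natrD natrM exprS; field.
by rewrite expf_neq0.
Qed.

Let approx_nd b m n : (m <= n)%N -> approx b m <= approx b n.
Proof.
move=> /subnK <-; elim: (n - m)%N => [|k IH]; first by rewrite add0n.
by rewrite addSn approxS (le_trans IH)// lerDl.
Qed.

(** In units of [4 ^- n], the next digit adds at most 1/4 while the margin drops from 1/2 to 1/8. *)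
Let approx_ub_ni b m n : (m <= n)%N ->
  approx b n + 2^-1 / 4 ^+ n <= approx b m + 2^-1 / 4 ^+ m.
Proof.
move=> /subnK <-; elim: (n - m)%N => [|k IH]; first by rewrite add0n.
apply: le_trans IH; rewrite addSn approxS -addrA lerD2l exprS.
have : 0 < (4 ^+ (k + m) : R)^-1 by rewrite invr_gt0 exprn_gt0.
rewrite invfM; case: (b _) => /=; lra.
Qed.

Lemma code_bounds b n :
  (prefix_code b n)%:R <= 4 ^+ n * fine (code b) <=
    (prefix_code b n)%:R + 2^-1.
Proof.
have lo k : ((approx b k)%:E <= code b)%E.
  by apply: ereal_sup_ubound; exists k.
have up k : (code b <= (approx b k + 2^-1 / 4 ^+ k)%:E)%E.
  apply: ge_ereal_sup => _ [m _ <-]; rewrite lee_fin.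
  have pos i : 0 <= 2^-1 / 4 ^+ i :> R by rewrite divr_ge0.
  have [mk|/ltnW km] := leqP m k.
    by rewrite (le_trans (approx_nd b mk))// lerDl.
  by rewrite (le_trans _ (approx_ub_ni b km))// lerDl.
have fin : code b \is a fin_num.
  rewrite fin_numE -ltNye -ltey.
  by rewrite (lt_le_trans _ (lo 0)) ?ltNyr// (le_lt_trans (up 0)) ?ltry.
have := lo n; have := up n; rewrite -(fineK fin) !lee_fin /approx.
have p : 0 < 4 ^+ n :> R by rewrite exprn_gt0.
rewrite -mulrDl ler_pdivlMr// ler_pdivrMr// mulrC => -> ->.
by [].
Qed.

Lemma codeK b n : digit n (code b) <-> b n.
Proof.
have := code_bounds b n.+1; rewrite /digit; set x := 4 ^+ _ * _ => /andP[lo up].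
split=> [[m _ /= /andP[mx xm]]|bn].
  (* The margin 1/2 is below 1, so the two bounds force [prefix_code b n.+1] to be [m.*2.+1]; its
     parity is that of [b n]. *)
  have h1 : (m.*2.+1 <= prefix_code b n.+1)%N.
    rewrite -ltnS -(ltr_nat R); apply: le_lt_trans mx _.
    by apply: le_lt_trans up _; rewrite -[ltRHS]natr1 ltrD2l invf_lt1// ltr1n.
  have h2 : (prefix_code b n.+1 < m.*2.+2)%N.
    by rewrite -(ltr_nat R); apply: le_lt_trans xm.
  move: h1 h2 => /=; case: (b n) => //=; lia.
exists (prefix_code b n).*2 => //=; move: lo up; rewrite /= bn.
rewrite (_ : (4 * _ + _ = (prefix_code b n).*2.*2.+1)%N);
  last by rewrite /=; lia.
move=> -> up /=; apply: le_lt_trans up _.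
by rewrite -[in ltRHS]natr1 ltrD2l invf_lt1// ltr1n.
Qed.

Lemma measurable_code d (T : measurableType d) (b : T -> nat -> bool) :
  (forall n, measurable [set x | b x n]) ->
  measurable_fun setT (fun x => code (b x)).
Proof.
move=> mb; apply: measurable_fun_esups => n; apply/measurable_EFinP => /=.
apply: measurable_funM => //.
elim: n => [|n IH] //=; under eq_fun do rewrite natrD natrM.
apply: measurable_funD; first exact: measurable_funM.
rewrite (_ : (fun x => (b x n)%:R) = \1_[set x | b x n])//.
by apply/funext => x; rewrite indicE; congr ((nat_of_bool _)%:R);
  apply/idP/idP; rewrite inE.
Qed.

End quaternary_code.

(** * Measurable choice of a first index *)

Section first_index.

Definition first_index (P : nat -> bool) (dflt : nat) : nat :=
  if pselect (exists i, P i) is left h then ex_minn h else dflt.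

Lemma first_indexP (P : nat -> bool) dflt :
  (exists i, P i) -> P (first_index P dflt).
Proof.
by move=> Pi; rewrite /first_index; case: pselect => // h; case: ex_minnP.
Qed.

(** This form uses only countable Boolean combinations of the conditions [P j], hence gives
    measurability when [P] depends on a parameter. *)
Lemma first_indexE (P : nat -> bool) dflt i : first_index P dflt = i <->
  (P i /\ forall j, (j < i)%N -> ~ P j) \/ (dflt = i /\ forall j, ~ P j).
Proof.
rewrite /first_index; case: pselect => [h|h]; last first.
  split=> [<-|[[Pi _]|[]//]]; last by case: h; exists i.
  by right; split => // j Pj; apply: h; exists j.
case: ex_minnP => m Pm minm; split=> [<-|[[Pi mini]|[_ nP]]].
- by left; split => // j jm Pj; have := minm _ Pj; rewrite leqNgt jm.
- apply/eqP; rewrite eqn_leq minm//= leqNgt; apply/negP => /mini; exact.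
- by have := nP _ Pm.
Qed.

Lemma measurable_first_index d (T : measurableType d) (P : T -> nat -> bool)
    dflt i : (forall i, measurable [set t | P t i]) ->
  measurable [set t | first_index (P t) dflt = i].
Proof.
move=> mP; rewrite [X in measurable X](_ : _ =
  ([set t | P t i] `&`
    \bigcap_(j in [set j | (j < i)%N]) ~` [set t | P t j]) `|`
  (if dflt == i then \bigcap_j ~` [set t | P t j] else set0)).
  apply: measurableU; last first.
    by case: ifP => // _; apply: bigcapT_measurable => j; exact: measurableC.
  apply: measurableI => //; apply: bigcap_measurableType => j _.
  exact: measurableC.
apply/seteqP; split => t /=.
  move=> /first_indexE[[Pi mini]|[-> nP]]; first by left; split.
  by right; rewrite eqxx => j _; exact: nP.
case=> [[Pi mini]|]; first by apply/first_indexE; left; split.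
by case: eqP => // -> nP; apply/first_indexE; right; split => // j; exact: nP.
Qed.

End first_index.

(** * Measurable encoding of a Polish space into the extended line, and its decoding *)

Section polish.
Context {R : realType} {E : ptopologicalType} (d : E -> E -> R) (q : nat -> E).
Hypothesis d_ge0 : forall x y, 0 <= d x y.
Hypothesis d_eq0 : forall x y, d x y = 0 <-> x = y.
Hypothesis d_sym : forall x y, d x y = d y x.
Hypothesis d_triangle : forall x y z, d x z <= d x y + d y z.
Hypothesis d_nbhs : forall (x : E) (U : set E),
  nbhs x U <-> exists2 e : R, 0 < e & [set y | d x y < e] `<=` U.
Hypothesis d_complete : forall u : nat -> E,
  (forall e : R, 0 < e -> exists N : nat, forall m n : nat,
    (N <= m)%N -> (N <= n)%N -> d (u m) (u n) < e) ->
  exists l : E, u @ \oo --> l.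
Hypothesis q_dense : forall x (e : R), 0 < e -> exists i, d x (q i) < e.

Let d_refl x : d x x = 0. Proof. exact/d_eq0. Qed.

Let ball x e := [set y | d x y < e].

Let open_ball x e : open (ball x e).
Proof.
rewrite openE => y xy; apply/d_nbhs; exists (e - d x y).
  by rewrite subr_gt0.
move=> z /= yz; apply: le_lt_trans (d_triangle x y z) _.
by rewrite -ltrBrDl.
Qed.

Lemma cvg_dist (u : nat -> E) l : u @ \oo --> l <->
  forall e, 0 < e -> exists N, forall n, (N <= n)%N -> d l (u n) < e.
Proof.
split=> [ul e e0|ul U /d_nbhs[e e0 eU]].
  have /ul : nbhs l (ball l e) by apply/d_nbhs; exists e.
  by case=> N _ HN; exists N => n Nn; exact: HN.
have [N HN] := ul e e0.
by exists N => // n /= Nn; apply: eU; exact: HN.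
Qed.

Let natV_lt (e : R) : 0 < e -> exists k, k.+1%:R^-1 < e.
Proof. by move=> /ltr_add_invr[k]; rewrite add0r; exists k. Qed.

Let box (i j k : nat) : set (borel E * borel E) :=
  ball (q i) k.+1%:R^-1 `*` ball (q j) k.+1%:R^-1.

(** By separability, an open set of the product is a countable union of boxes with centres in [q]
    and radii [k.+1%:R^-1]. *)
Lemma measurable_open_prod (O : set (E * E)) : open O ->
  measurable (O : set (borel E * borel E)).
Proof.
move=> oO; rewrite (_ : O = \bigcup_i \bigcup_j \bigcup_k
    (if `[< box i j k `<=` O >] then box i j k else set0)).
  apply: bigcupT_measurable => i; apply: bigcupT_measurable => j.
  apply: bigcupT_measurable => k; case: ifP => // _.
  by apply: measurableX; apply: sub_sigma_algebra; exact: open_ball.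
apply/seteqP; split => [[x y] Oxy|p [i _ [j _ [k _]]]]; last first.
  by case: ifPn => // /asboolP; apply.
have [[U V] /= [/d_nbhs[e1 e10 eU] /d_nbhs[e2 e20 eV]] UVO] :
    nbhs (x, y) O by exact: open_nbhs_nbhs.
(* Half of the smaller radius, since a point of the box is reached in two steps, through a
   centre. *)
have [k ke] : exists k, k.+1%:R^-1 < Num.min e1 e2 / 2.
  by apply: natV_lt; rewrite divr_gt0// lt_min e10.
have kgt0 : 0 < k.+1%:R^-1 :> R by rewrite invr_gt0.
have [i xi] := q_dense x kgt0; have [j yj] := q_dense y kgt0.
have h z w z' (e : R) : Num.min e1 e2 <= e -> d z w < k.+1%:R^-1 ->
    d w z' < k.+1%:R^-1 -> d z z' < e.
  move=> le_e zw wz'; apply: lt_le_trans le_e.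
  apply: le_lt_trans (d_triangle z w z') _; rewrite [ltRHS]splitr.
  by apply: ltrD; apply: lt_trans ke.
exists i => //; exists j => //; exists k => //; rewrite ifT.
  by split; rewrite /ball /= d_sym.
apply/asboolP => -[z w] [/= iz jw]; apply: UVO; split => /=.
  by apply: eU; apply: h xi iz; rewrite ge_min lexx.
by apply: eV; apply: h yj jw; rewrite ge_min lexx orbT.
Qed.

(** The bits record proximity to each dense point at each dyadic scale, which determines [x]. *)
Let bit (x : E) (n : nat) : bool :=
  if @unpickle (nat * nat)%type n is Some (m, i)
  then d x (q i) < 2^-1 ^+ m else false.

Let near_digit (m i : nat) (t : \bar R) : bool :=
  `[< digit (pickle (m, i)) t >].

Let near_digitE x m i : near_digit m i (code (bit x)) = (d x (q i) < 2^-1 ^+ m).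
Proof.
rewrite /near_digit; apply/asboolP/idP => [/codeK|h]; last apply/codeK.
  by rewrite /bit pickleK.
by rewrite /bit pickleK.
Qed.

Definition encode (x : E) : \bar R := code (bit x).

(* Accepting only points close to the previous one makes the decoding a Cauchy
   sequence even off the range of [encode]. *)
Fixpoint decode_index (t : \bar R) (n : nat) : nat :=
  if n is m.+1 then
    let j := decode_index t m in
    first_index
      (fun i => near_digit n i t && (d (q i) (q j) < 2 * 2^-1 ^+ m)) j
  else first_index (fun i => near_digit 0 i t) 0.

Definition decode (t : \bar R) : E :=
  xget point [set l | (fun n => q (decode_index t n)) @ \oo --> l].

Let decode_step t n :
  d (q (decode_index t n)) (q (decode_index t n.+1)) < 2 * 2^-1 ^+ n.
Proof.
rewrite /=; set j := decode_index t n.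
set i := first_index _ _; have /first_indexE : i = i by [].
(* Either the new index passed the closeness test, or the default [j] was kept and the distance is
   0. *)
case=> [[/andP[_]]|[<- _]]; first by rewrite d_sym.
by rewrite d_refl mulr_gt0// exprn_gt0// invr_gt0.
Qed.

(** The bound is the partial geometric sum of the bounds in [decode_step]. *)
Let decode_index_dist t n k :
  d (q (decode_index t n)) (q (decode_index t (n + k))) <=
  4 * 2^-1 ^+ n - 4 * 2^-1 ^+ (n + k).
Proof.
elim: k => [|k IH]; first by rewrite addn0 d_refl subrr.
apply: le_trans (d_triangle _ (q (decode_index t (n + k))) _) _.
have := decode_step t (n + k); rewrite addnS [in X in _ -> X]exprS.
move: IH; lra.
Qed.

Let half_pow_lt (e : R) : 0 < e -> exists N, 2^-1 ^+ N < e.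
Proof.
move=> e0.
have : (2^-1 ^+ n : R) @[n --> \oo] --> 0.
  by apply: cvg_expr; rewrite ger0_norm ?invf_lt1 ?ltr1n.
move=> /cvgrPdist_lt /(_ _ e0)[N _ HN]; exists N.
have := HN N (leqnn N); rewrite sub0r normrN ger0_norm//.
Qed.

(** The steps are summable for every [t], so completeness provides a limit and [decode] never falls
    back on [point]. *)
Let cvg_decode t : (fun n => q (decode_index t n)) @ \oo --> decode t.
Proof.
rewrite /decode; case: xgetP => [l _ //|/= noL]; exfalso.
have [|l ul] := @d_complete (fun n => q (decode_index t n)); last exact: noL ul.
(* With [e / 8], the tail bound [4 * 2^-1 ^+ N] is below [e / 2]. *)
move=> e e0; have [N HN] : exists N, 2^-1 ^+ N < e / 8.
  by apply: half_pow_lt; rewrite divr_gt0.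
have close n : (N <= n)%N ->
    d (q (decode_index t N)) (q (decode_index t n)) < e / 2.
  move=> Nn; rewrite -(subnKC Nn).
  have p : 0 < 2^-1 ^+ (N + (n - N)) :> R by rewrite exprn_gt0// invr_gt0.
  apply: le_lt_trans (decode_index_dist t N (n - N)) _; lra.
exists N => m n Nm Nn.
apply: le_lt_trans (d_triangle _ (q (decode_index t N)) _) _.
rewrite d_sym; have := close m Nm; have := close n Nn; lra.
Qed.

(** On the code of [x], the [n]-th selected point stays within [2^-1 ^+ n] of [x], so the decoded
    limit is [x]. *)
Lemma encodeK : cancel encode decode.
Proof.
move=> x; set t := encode x.
have near n : d x (q (decode_index t n)) < 2^-1 ^+ n.
  elim: n => [|n IH].
    rewrite -near_digitE.
    have /(@first_indexP _ 0%N) // : exists i, near_digit 0 i t.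
    have [i xi] := q_dense x ltr01; exists i.
    by rewrite near_digitE expr0.
  rewrite -near_digitE /=; set j := decode_index t n.
  set P := fun i => _.
  have /(@first_indexP _ j)/andP[] // : exists i, P i.
  (* A dense point this close to [x] is within [2^-1 ^+ n.+1 + 2^-1 ^+ n] of the previous one, below
     the tolerance [2 * 2^-1 ^+ n]: the search succeeds. *)
  have [|i xi] := @q_dense x (2^-1 ^+ n.+1).
    by rewrite exprn_gt0// invr_gt0.
  exists i; rewrite /P near_digitE xi /=.
  apply: le_lt_trans (d_triangle _ x _) _; rewrite d_sym.
  move: xi IH; rewrite exprS -/j.
  have : 0 < 2^-1 ^+ n :> R by rewrite exprn_gt0// invr_gt0.
  lra.
apply/esym/d_eq0/eqP; rewrite eq_le d_ge0 andbT; apply/ler_addgt0Pr => e e0.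
rewrite add0r; have e20 : 0 < e / 2 by rewrite divr_gt0.
have [N1 H1] := (cvg_dist _ _).1 (@cvg_decode t) _ e20.
have [N2 H2] := half_pow_lt e20.
apply: le_trans (d_triangle _ (q (decode_index t (maxn N1 N2))) _) _.
rewrite [e]splitr; apply: lerD; last first.
  by rewrite d_sym ltW// H1// leq_maxl.
apply: ltW; apply: lt_trans (near _) _; apply: le_lt_trans H2.
by rewrite ler_wiXn2l ?leq_maxr// invf_le1 ?ler1n.
Qed.

Lemma measurable_encode :
  measurable_fun [set: borel E] (encode : borel E -> \bar R).
Proof.
apply: (@measurable_code _ _ (borel E)) => n; rewrite /bit.
case: (@unpickle (nat * nat)%type n) => [[m i]|]; last first.
  by rewrite (_ : mkset _ = set0)//; apply/seteqP; split.
apply: sub_sigma_algebra.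
rewrite (_ : mkset _ = ball (q i) (2^-1 ^+ m)); first exact: open_ball.
by apply/seteqP; split => x /=; rewrite d_sym.
Qed.

Let measurable_decode_index n i : measurable [set t | decode_index t n = i].
Proof.
elim: n i => [|n IH] i.
  apply: measurable_first_index => j.
  rewrite (_ : mkset _ = digit (pickle (0%N, j)));
    first exact: measurable_digit.
  by apply/seteqP; split => t /asboolP.
(* Splitting along the previous index makes the acceptance test depend on a constant [j]. *)
rewrite (_ : mkset _ = \bigcup_j ([set t | decode_index t n = j] `&`
  [set t | first_index (fun i => near_digit n.+1 i t &&
     (d (q i) (q j) < 2 * 2^-1 ^+ n)) j = i])); last first.
  apply/seteqP; split => t /=; first by exists (decode_index t n).
  by move=> [_ _ [<-]].
apply: bigcupT_measurable => j; apply: measurableI => //.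
apply: measurable_first_index => k.
case: (d _ _ < _); last first.
  rewrite (_ : mkset _ = set0)//; apply/seteqP; split => t //=.
  by rewrite andbF.
rewrite (_ : mkset _ = digit (pickle (n.+1, k))); first exact: measurable_digit.
by apply/seteqP; split => t /=; rewrite andbT => /asboolP.
Qed.

Lemma measurable_decode : measurable_fun setT (decode : \bar R -> borel E).
Proof.
apply: (@measurability _ _ (\bar R : measurableType _) (borel E) setT decode
  (@open E) erefl) => // _ [U oU <-]; rewrite setTI.
(* The limit lies in [U] exactly when, for some [k], the selected points are eventually centres of
   balls of radius [k.+1%:R^-1] inside [U]. *)
rewrite (_ : _ @^-1` _ = \bigcup_k \bigcup_N \bigcap_(n in [set n | (N <= n)%N])
  \bigcup_(i in [set i | ball (q i) k.+1%:R^-1 `<=` U])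
    [set t | decode_index t n = i]).
  apply: bigcupT_measurable => k; apply: bigcupT_measurable => N.
  apply: bigcap_measurableType => n _; apply: bigcup_measurable => i _.
  exact: measurable_decode_index.
apply/seteqP; split => t.
  move=> Ut; have [e e0 eU] : exists2 e : R, 0 < e & ball (decode t) e `<=` U.
    by apply/d_nbhs; apply: open_nbhs_nbhs.
  have [k ke] : exists k, k.+1%:R^-1 < e / 2
    by apply: natV_lt; rewrite divr_gt0.
  have [|N HN] := (cvg_dist _ _).1 (@cvg_decode t) k.+1%:R^-1;
    first by rewrite invr_gt0.
  exists k => //; exists N => // n /= Nn; exists (decode_index t n) => //= y qy.
  apply: eU; apply: le_lt_trans (d_triangle _ (q (decode_index t n)) _) _.
  by rewrite [e]splitr; apply: ltrD; apply: lt_trans ke; [exact: HN|].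
move=> [k _ [N _ HN]].
have [|N' HN'] := (cvg_dist _ _).1 (@cvg_decode t) k.+1%:R^-1;
    first by rewrite invr_gt0.
have [i /= iU tE] := HN (maxn N N') (leq_maxl _ _).
by apply: iU; rewrite -tE /ball /= d_sym; apply: HN'; rewrite leq_maxr.
Qed.

End polish.

Lemma polish_dense_sequence (R : realType) (E : ptopologicalType)
    (d : E -> E -> R) :
    (forall (x : E) (U : set E),
      nbhs x U <-> exists2 e : R, 0 < e & [set y | d x y < e] `<=` U) ->
    (forall x y, 0 <= d x y) -> (forall x, d x x = 0) ->
    (forall x y z, d x z <= d x y + d y z) ->
    (exists2 D : set E, countable D & dense D) ->
  exists q : nat -> E, forall x (e : R), 0 < e -> exists i, d x (q i) < e.
Proof.
move=> d_nbhs d_ge0 d_refl d_triangle [D cD dD].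
have dD' x (e : R) : 0 < e -> exists2 y, D y & d x y < e.
  move=> e0; have [y [xy Dy]] : ([set y | d x y < e] `&` D) !=set0.
    apply: dD; first by exists x => /=; rewrite d_refl.
    rewrite openE => y /= xy; apply/d_nbhs; exists (e - d x y).
      by rewrite subr_gt0.
    move=> z /= yz; apply: le_lt_trans (d_triangle x y z) _.
    by rewrite -ltrBrDl.
  by exists y.
(* [f] inverts an injection of [D] into [nat]; numbers off its image give [None], later replaced by
   [point]. *)
have [f fD] : exists f : nat -> option E,
    forall y, D y -> exists n, f n = Some y.
  have /countable_injP[g ginj] := cD.
  exists (fun n => if pselect (exists2 y, D y & g y = n) is left h
    then Some (sval (cid2 h)) else None) => y Dy.
  exists (g y); case: pselect => [h|]; last by case; exists y.
  case: cid2 => z Dz gz /=; congr Some; apply: ginj => //; exact: mem_set.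
exists (fun n => odflt point (f n)) => x e /(dD' x)[y /fD[n fn] xy].
by exists n; rewrite fn.
Qed.

(** * Equality of image measures and of their integrals *)

Lemma eq_preimage_measure (R : realType) (d d1 d2 : measure_display)
    (T : measurableType d) (T1 : measurableType d1) (T2 : measurableType d2)
    (m1 : {measure set T1 -> \bar R}) (m2 : {measure set T2 -> \bar R})
    (f1 : T1 -> T) (f2 : T2 -> T) (G : set (set T)) :
    measurable_fun setT f1 -> measurable_fun setT f2 ->
    @measurable _ T = <<s G >> -> setI_closed G ->
    m1 setT = m2 setT -> (m1 setT < +oo)%E ->
    (forall A, G A -> m1 (f1 @^-1` A) = m2 (f2 @^-1` A)) ->
  forall A, measurable A -> m1 (f1 @^-1` A) = m2 (f2 @^-1` A).
Proof.
move=> mf1 mf2 GE GI m12 fin m12G A.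
have fin2 : (m2 setT < +oo)%E by rewrite -m12.
have mi1 B : measurable B -> measurable (f1 @^-1` B).
  by move=> mB; rewrite -[X in measurable X]setTI; exact: mf1.
have mi2 B : measurable B -> measurable (f2 @^-1` B).
  by move=> mB; rewrite -[X in measurable X]setTI; exact: mf2.
(* Equal finite total masses give closure under complements, countable additivity gives closure
   under disjoint unions. *)
rewrite GE; apply: (@dynkin_induction _ _ _
  (fun A => m1 (f1 @^-1` A) = m2 (f2 @^-1` A)) GE GI) => //.
- move=> F mF FE; have preimageC (U : Type) (f : U -> T) :
      f @^-1` (~` F) = setT `\` f @^-1` F by rewrite setTD.
  rewrite (preimageC _ f1) (preimageC _ f2) !measureD//.
  + by rewrite !setTI; congr (_ - _)%E.
  + exact: mi2.
  + exact: mi1.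
- move=> F mF tF FE.
  have tfF (U : Type) (f : U -> T) : trivIset setT (fun n => f @^-1` F n).
    apply/trivIsetP => i j _ _ ij; rewrite -preimage_setI.
    by move/trivIsetP : tF => /(_ _ _ _ _ ij) ->//; rewrite preimage_set0.
  rewrite (preimage_bigcup _ f1) (preimage_bigcup _ f2) !measure_bigcup//.
  + by apply: eq_eseriesr => n _.
  + by move=> n _; exact: mi2.
  + by move=> n _; exact: mi1.
Qed.

(** Both sides integrate [h] against a pushforward, and the two pushforwards agree. *)
Lemma eq_preimage_integral (R : realType) (d d1 d2 : measure_display)
    (T : measurableType d) (T1 : measurableType d1) (T2 : measurableType d2)
    (m1 : {measure set T1 -> \bar R}) (m2 : {measure set T2 -> \bar R})
    (f1 : T1 -> T) (f2 : T2 -> T) (h : T -> \bar R) :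
    measurable_fun setT f1 -> measurable_fun setT f2 -> measurable_fun setT h ->
    (forall x, (0 <= h x)%E) ->
    (forall A, measurable A -> m1 (f1 @^-1` A) = m2 (f2 @^-1` A)) ->
  (\int[m1]_x h (f1 x) = \int[m2]_x h (f2 x))%E.
Proof.
move=> mf1 mf2 mh h0 m12.
transitivity (\int[pushforward m1 f1]_x h x)%E.
  by rewrite ge0_integral_pushforward.
transitivity (\int[pushforward m2 f2]_x h x)%E.
  by apply: eq_measure_integral => A mA _; exact: m12.
by rewrite ge0_integral_pushforward.
Qed.

(** * Conditional probabilities as Radon-Nikodym densities *)

Section conditional_probability.
Context {R : realType} {d dE : measure_display} {W : measurableType d}
  {E : measurableType dE} (P : probability W R) (Y : {RV P >-> E}).
Local Open Scope ereal_scope.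

(** The measurability of [B] is an argument so that the measure structure can be attached to the set
    function itself. *)
Definition restricted_law (B : set W) of measurable B : set E -> \bar R :=
  fun C => P (Y @^-1` C `&` B).

Section restricted_law.
Variables (B : set W) (mB : measurable B).
Local Notation nu := (restricted_law mB).

Let mYB C : measurable C -> measurable (Y @^-1` C `&` B).
Proof. by move=> mC; apply: measurableI => //; exact: measurable_funPTI. Qed.

Let nu0 : nu set0 = 0.
Proof. by rewrite /restricted_law preimage_set0 set0I measure0. Qed.

Let nu_ge0 C : 0 <= nu C. Proof. exact: measure_ge0. Qed.

Let nu_sigma_additive : semi_sigma_additive nu.
Proof.
move=> F mF tF mUF; rewrite /restricted_law preimage_bigcup setI_bigcupl.
apply: measure_semi_sigma_additive.
- by move=> n; exact: mYB.
- apply/trivIsetP => /= i j _ _ ij; rewrite setIACA -preimage_setI.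
  by move/trivIsetP : tF => /(_ _ _ _ _ ij) ->//; rewrite preimage_set0 set0I.
- by apply: bigcupT_measurable => n; exact: mYB.
Qed.

HB.instance Definition _ := isMeasure.Build _ _ _ nu
  nu0 nu_ge0 nu_sigma_additive.

Let nu_fin : fin_num_fun nu.
Proof.
by move=> C mC; rewrite /restricted_law fin_num_measure//; exact: mYB.
Qed.

HB.instance Definition _ := Measure_isFinite.Build _ _ _ nu nu_fin.

Lemma restricted_law_dominated : nu `<< distribution P Y.
Proof.
apply/null_content_dominatesP => C mC PC0; apply/eqP.
rewrite eq_le nu_ge0 andbT -PC0.
by apply: le_measure; rewrite ?inE//; [exact: mYB|exact: measurable_funPTI].
Qed.

End restricted_law.

(** The densities for [B] and for its complement add up to 1 almost everywhere. Hence truncating the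
    first one at 1 bounds it everywhere without changing its integrals. *)
Lemma conditional_probability (B : set W) : measurable B ->
  exists f : E -> \bar R, [/\ forall x, 0 <= f x <= 1, measurable_fun setT f &
    forall C, measurable C ->
      P (Y @^-1` C `&` B) = \int[distribution P Y]_(x in C) f x].
Proof.
move=> mB.
have [f [f0 intf fE]] := radon_nikodym_finite (restricted_law_dominated mB).
have [f' [f'0 intf' f'E]] :=
  radon_nikodym_finite (restricted_law_dominated (measurableC mB)).
have mf := measurable_int _ intf.
exists (fun x => mine (f x) 1); split.
- by move=> x; rewrite ge_min lexx orbT andbT le_min f0 lee01.
- exact: measurable_mine.
move=> C mC; rewrite -/(restricted_law mB C) fE//; apply: ae_eq_integral => //.
- exact: measurable_funTS.
- by apply: measurable_funTS; exact: measurable_mine.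
have : ae_eq (distribution P Y) setT (f \+ f') (cst 1).
  apply: integral_ae_eq => //.
    exact: integrableD.
  move=> D _ mD; rewrite ge0_integralD//; last 2 first.
    exact/measurable_funTS/measurable_int/intf.
    exact/measurable_funTS/measurable_int/intf'.
  rewrite -fE// -f'E// integral_cst// mul1e /= /restricted_law -measureU.
  - rewrite -setIUr setUv setIT//.
  - by apply: measurableI => //; exact: measurable_funPTI.
  - by apply: measurableI; [exact: measurable_funPTI|exact: measurableC].
  - by rewrite setIACA setICr setI0.
apply: filterS => x /(_ I) /= ff' _; rewrite min_l//.
by rewrite -ff' leeDl.
Qed.

End conditional_probability.

(** * Events of prescribed conditional probability from a uniform coordinate *)

Section uniform_subgraph.
Context {R : realType} {d : measure_display} {W : measurableType d}
  (P : probability W R).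
Local Open Scope ereal_scope.

Local Notation unif := (uniform_prob (@ltr01 R)).

Lemma unif_below (f : \bar R) : 0 <= f <= 1 ->
  unif [set u : measurableTypeR R | u%:E < f] = f.
Proof.
case: f => [r||]; rewrite ?lee_fin; last by [].
  move=> /andP[r0 r1]; rewrite /= /uniform_prob integral_uniform_pdf.
  rewrite (eq_integral (cst 1)); last first.
    move=> x; rewrite inE => -[_ /=]; rewrite in_itv/= /uniform_pdf => ->.
    by rewrite subr0 invr1.
  rewrite (_ : _ `&` _ = `[0%R, r[%classic); last first.
    apply/seteqP; split => x /=; rewrite !in_itv/= lte_fin.
      by move=> [-> /andP[->]].
    by move=> /andP[-> xr]; split => //=; rewrite (le_trans (ltW xr)).
  rewrite integral_cst//= mul1e lebesgue_measure_itv/= lte_fin.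
  by case: ltgtP r0 => // [_ _|<- _]; rewrite ?oppr0 ?adde0// sube0.
by move=> /andP[_]; rewrite leye_eq.
Qed.

Definition subgraph (f : W -> \bar R) : set (W * measurableTypeR R) :=
  [set p | (p.2 : R)%:E < f p.1].

Lemma measurable_subgraph f : measurable_fun setT f ->
  measurable (subgraph f).
Proof.
move=> mf; rewrite -[X in measurable X]setTI.
apply: measurable_lte => //.
  apply/measurable_EFinP; exact: measurable_snd.
exact: measurableT_comp.
Qed.

(** Over [w] in [A] the section has uniform measure [f w]; over other points it is empty. *)
Lemma measure_subgraph f (A : set W) : measurable A ->
    measurable_fun setT f -> (forall x, 0 <= f x <= 1) ->
  (P \x unif) ((A `*` setT) `&` subgraph f) = \int[P]_(x in A) f x.
Proof.
move=> mA mf f01; rewrite /product_measure1 [RHS]integral_mkcond.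
apply: eq_integral => w _ /=; rewrite patchE.
case: ifPn => [wA|wA].
  rewrite -[RHS]unif_below//; apply: (congr1 (unif : set _ -> \bar R)).
  apply/seteqP; split => u.
    by rewrite /xsection /= inE => -[].
  by rewrite /xsection /= inE => h; split => //; split => //; rewrite inE in wA.
rewrite (_ : xsection _ _ = set0) ?measure0//.
apply/seteqP; split => u //; rewrite /xsection /= inE => -[[/= Aw _] _].
by rewrite notin_setE in wA.
Qed.

End uniform_subgraph.

(** * Rebuilding a variable with a given joint law from a uniform coordinate *)

Section outsourcing.
Context {R : realType} {d1 d2 dE : measure_display} {W1 : measurableType d1}
  {W2 : measurableType d2} {E : measurableType dE}
  (P1 : probability W1 R) (P2 : probability W2 R)
  (Y1 : {RV P1 >-> E}) (Y2 : {RV P2 >-> E}) (T2 : W2 -> \bar R).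
Hypothesis mT2 : measurable_fun setT T2.
Hypothesis Y1Y2 : forall A, measurable A -> P1 (Y1 @^-1` A) = P2 (Y2 @^-1` A).
Local Open Scope ereal_scope.

Local Notation unif := (uniform_prob (@ltr01 R)).
Local Notation M := (P1 \x unif).
Let cyl C : set (W1 * measurableTypeR R) := (Y1 @^-1` C) `*` setT.
Let B (t : R) := T2 @^-1` `]-oo, t%:E[.

Let mcyl C : measurable C -> measurable (cyl C).
Proof. by move=> mC; apply: measurableX => //; exact: measurable_funPTI. Qed.

Let mT2i D : measurable D -> measurable (T2 @^-1` D).
Proof. by move=> mD; rewrite -[X in measurable X]setTI; exact: mT2. Qed.

Let mYB C D : measurable C -> measurable D ->
  measurable (Y2 @^-1` C `&` T2 @^-1` D).
Proof.
by move=> mC mD; apply: measurableI; [exact: measurable_funPTI|exact: mT2i].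
Qed.

Let mYBt C t : measurable C -> measurable (Y2 @^-1` C `&` B t).
Proof. by move=> mC; apply: mYB => //; exact: emeasurable_itv. Qed.

Let B_nd s t : (s <= t)%R -> B s `<=` B t.
Proof.
move=> st w; rewrite /B /= !in_itv/= => /lt_le_trans; apply.
by rewrite lee_fin.
Qed.

(** Take for [f] the conditional probability of [T2 < t] given [Y2]; it can be evaluated at [Y1]
    because [Y1] and [Y2] have the same law. *)
Let exists_subgraph (t : R) : exists f : E -> \bar R,
  measurable_fun setT f /\ forall C, measurable C ->
    M (cyl C `&` subgraph (f \o Y1)) = P2 (Y2 @^-1` C `&` B t).
Proof.
have [f [f01 mf fE]] :=
  conditional_probability Y2 (mT2i (emeasurable_itv `]-oo, t%:E[)).
exists f; split => // C mC; rewrite fE// measure_subgraph//.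
- transitivity (\int[distribution P1 Y1]_(x in C) f x).
    rewrite ge0_integral_pushforward//; first exact: measurable_funTS.
    by move=> x _; have /andP[] := f01 x.
  by apply: eq_measure_integral => A mA _; exact: Y1Y2.
- exact: measurable_funPTI.
- exact: measurableT_comp.
- by move=> x; exact: f01.
Qed.

Let f (t : R) : E -> \bar R := sval (cid (exists_subgraph t)).

Let mf t : measurable_fun setT (f t).
Proof. by rewrite /f; case: cid => ? []. Qed.

Let A t := subgraph (f t \o Y1).

Let mA t : measurable (A t).
Proof. by apply: measurable_subgraph; exact: measurableT_comp. Qed.

Let ME t C : measurable C -> M (cyl C `&` A t) = P2 (Y2 @^-1` C `&` B t).
Proof. by rewrite /A /f; case: cid => ? [? +]; exact. Qed.

(* The densities are chosen separately for each [t], hence are monotone in [t]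
   only up to null sets. *)
Let A_ae_nd s t : (s <= t)%R -> M (A s `\` A t) = 0.
Proof.
(* [C] is where the densities are in the wrong order. There [A t] lies inside [A s], so the measure
   of the difference is [P2] of the part with [B s] minus that with [B t], which is at most 0. *)
move=> st; pose C := [set x | f t x < f s x].
have mC : measurable C by rewrite -[C]setTI; exact: measurable_lte.
have At_As : cyl C `&` A t `<=` cyl C `&` A s.
  by move=> p [Cp Ap]; split => //; apply: lt_trans Ap _; case: Cp.
have -> : A s `\` A t = (cyl C `&` A s) `\` (cyl C `&` A t).
  apply/seteqP; split => p.
    move=> [Asp /negP]; rewrite -leNgt => ftp.
    have Cp : cyl C p by split => //=; exact: le_lt_trans ftp Asp.
    by split => // -[_]; rewrite /A /subgraph /= ltNge ftp.
  by move=> [[Cp Asp] nAt]; split => // Atp; apply: nAt.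
have m1 u : measurable (cyl C `&` A u) by apply: measurableI => //; exact: mcyl.
rewrite measureD//; last first.
  by rewrite (le_lt_trans (probability_le1 _ _)) ?ltry.
rewrite (setIidr At_As) /= !ME//; apply/eqP; rewrite eq_le; apply/andP; split.
  rewrite sube_le0; apply: le_measure; rewrite ?inE; [exact: mYBt|exact: mYBt|].
  by apply: setIS; exact: B_nd.
rewrite -(ME _ mC) -(ME _ mC) sube_ge0; last first.
  apply/orP; left; rewrite ge0_fin_numE ?measure_ge0//.
  by rewrite (le_lt_trans (probability_le1 _ _)) ?ltry.
by apply: le_measure; rewrite ?inE.
Qed.

(* Conditionally on [Y1 = y] this is the quantile transform of a uniform
   variable for the conditional law of [T2] given [Y2 = y], with distribution
   function [t |-> f t y]. *)
Definition outsourced (p : W1 * measurableTypeR R) : \bar R :=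
  ereal_inf [set (ratr q : R)%:E | q in [set q : rat | A (ratr q) p]].

(** Taking the infimum over rationals keeps this union countable, so measurability and null sets
    survive it. *)
Let outsourced_lt t : outsourced @^-1` `]-oo, t%:E[ =
  \bigcup_(q : rat) (if (ratr q < t)%R then A (ratr q) else set0).
Proof.
apply/seteqP; split => p; rewrite /= in_itv/=.
  by move=> /ereal_inf_lt[_ [q Aq <-]]; rewrite lte_fin => qt;
    exists q => //; rewrite qt.
move=> [q _]; case: ifPn => // qt Aq; apply: le_lt_trans (_ : (ratr q)%:E < _).
  by apply: ereal_inf_lbound; exists q.
by rewrite lte_fin.
Qed.

Let m_outsourced_lt t : measurable (outsourced @^-1` `]-oo, t%:E[).
Proof.
rewrite outsourced_lt; apply: bigcupT_measurable_rat => q.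
by case: ifP.
Qed.

Lemma measurable_outsourced : measurable_fun setT outsourced.
Proof.
apply: (measurability _ (ErealGenInftyO.measurableE R)).
by move=> _ [_ [t ->] <-]; rewrite setTI; exact: m_outsourced_lt.
Qed.

(** The event [outsourced < t] lies in [A t] up to a null set, by almost sure monotonicity at
    rational levels. Conversely it contains [A (ratr q)] for each rational [q] below [t], and these
    exhaust the mass because [B] is left-continuous. *)
Let outsourced_ray C t : measurable C ->
  M (cyl C `&` outsourced @^-1` `]-oo, t%:E[) = P2 (Y2 @^-1` C `&` B t).
Proof.
move=> mC; set S := outsourced @^-1` _.
have mS : measurable S by exact: m_outsourced_lt.
have mCS : measurable (cyl C `&` S) by apply: measurableI => //; exact: mcyl.
have mCA s : measurable (cyl C `&` A s)
  by apply: measurableI => //; exact: mcyl.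
apply/eqP; rewrite eq_le; apply/andP; split.
  rewrite -(ME t mC).
  have mSA : measurable (S `\` A t) by exact: measurableD.
  have SA0 : M (S `\` A t) = 0.
    apply: measure_negligible => //.
    pose N n := if @unpickle rat n is Some q then
      (if (ratr q < t)%R then A (ratr q) `\` A t else set0) else set0.
    apply: (@negligibleS _ _ _ _ (\bigcup_n N n)).
      rewrite /S outsourced_lt => p [[q _]]; case: ifPn => // qt Aq nAt.
      have Nq : N (pickle q) p by rewrite /N pickleK qt.
      exact: (ex_intro2 _ _ (pickle q) I Nq).
    apply: negligible_bigcup => n; rewrite /N.
    case: unpickle => [q|]; last exact: negligible_set0.
    case: ifPn => [qt|_]; last exact: negligible_set0.
    by apply/negligibleP; [exact: measurableD|exact/A_ae_nd/ltW].
  have CS : cyl C `&` S `<=` (cyl C `&` A t) `|` (S `\` A t).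
    by move=> p [Cp Sp]; have [Ap|nAp] := pselect (A t p); [left|right].
  have SA_le0 : M (S `\` A t) <= 0 by rewrite SA0.
  apply: (@le_trans _ _ (M ((cyl C `&` A t) `|` (S `\` A t)))).
    by apply: le_measure; rewrite ?inE//; exact: measurableU.
  apply: le_trans (measureU2 _ _ _) _ => //.
  by rewrite -[leRHS]adde0; apply: leeD; [exact: lexx|exact: SA_le0].
pose t_ n : R := (t - n.+1%:R^-1)%R.
have BE : Y2 @^-1` C `&` B t = \bigcup_n (Y2 @^-1` C `&` B (t_ n)).
  rewrite -setI_bigcupr; congr (_ `&` _); apply/seteqP; split=> w; last first.
    move=> [n _]; apply: B_nd; rewrite /t_ gerBl invr_ge0//.
  rewrite /B /= in_itv/= => wt.
  (* [T2 w] may be [-oo], so a real number between it and [t] is taken first. *)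
  have [s /andP[ws st]] : exists s : R, (T2 w <= s%:E) && (s < t)%R.
    move: wt; case: (T2 w) => [r||]; rewrite ?lte_fin => rt //.
      by exists r; rewrite lexx.
    by exists (t - 1)%R; rewrite leNye ltrBlDr ltrDl ltr01.
  have [n sn] := ltr_add_invr st.
  exists n => //=; rewrite in_itv/=; apply: le_lt_trans ws _.
  by rewrite lte_fin /t_ ltrBrDr.
have cvB : P2 (Y2 @^-1` C `&` B (t_ n)) @[n --> \oo] -->
    P2 (Y2 @^-1` C `&` B t).
  rewrite BE; apply: nondecreasing_cvg_mu.
  - by move=> n; exact: mYBt.
  - by apply: bigcupT_measurable => n; exact: mYBt.
  - move=> m n mn; apply/subsetPset; apply: setIS; apply: B_nd.
    by rewrite lerB// lef_pV2 ?posrE// ler_nat.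
rewrite -(cvg_lim _ cvB)//; apply: lime_le.
  by apply/cvg_ex; eexists; exact: cvB.
apply: nearW => n.
(* A rational level between [t_ n] and [t] links [B (t_ n)] to the event for [outsourced]. *)
have [q /andP[qt tq]] : exists q : rat, (t_ n < ratr q < t)%R.
  have : (t_ n < t)%R by rewrite ltrBlDr ltrDl invr_gt0.
  by move=> /rat_in_itvoo[q]; rewrite in_itv/= => qq; exists q.
apply: (@le_trans _ _ (P2 (Y2 @^-1` C `&` B (ratr q)))).
  apply: le_measure; rewrite ?inE; [exact: mYBt|exact: mYBt|].
  by apply: setIS; apply: B_nd; exact: ltW.
rewrite -(ME (ratr q) mC); apply: le_measure; rewrite ?inE//.
apply: setIS => p Ap; rewrite /S outsourced_lt; exists q => //.
by rewrite tq.
Qed.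

(** For fixed [C] both sides are finite measures in [D], and rays form a generating family stable
    under intersection. *)
Let outsourced_rectangle C D : measurable C -> measurable D ->
  M (cyl C `&` outsourced @^-1` D) = P2 (Y2 @^-1` C `&` T2 @^-1` D).
Proof.
move=> mC mD; have mYC : measurable (Y2 @^-1` C) by exact: measurable_funPTI.
have MC : M (cyl C) = P2 (Y2 @^-1` C).
  rewrite /cyl product_measure1E//; last exact: measurable_funPTI.
  by rewrite -Y1Y2// -[RHS]mule1; congr (_ * _); exact: probability_setT.
suff key F : measurable F ->
    mrestr M (mcyl mC) (outsourced @^-1` F) = mrestr P2 mYC (T2 @^-1` F).
  by have := key D mD; rewrite /mrestr setIC => ->; rewrite setIC.
apply: (eq_preimage_measure measurable_outsourced mT2
  (ErealGenInftyO.measurableE R)).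
- move=> _ _ [s ->] [t ->]; exists (Order.min s t).
  apply/seteqP; split => x /=; rewrite !in_itv/= EFin_min lt_min.
    by move=> [-> ->].
  by move=> /andP.
- by rewrite /= /mrestr !setTI.
- by rewrite /= /mrestr setTI (le_lt_trans (probability_le1 _ _)) ?ltry//;
    exact: mcyl.
- move=> _ [t ->]; rewrite /= /mrestr setIC.
  by apply: etrans (outsourced_ray t mC) _; rewrite setIC.
Qed.

(** Rectangles generate the product sigma-algebra and are stable under intersection. *)
Lemma outsourced_law G : measurable G ->
  M ((fun p => (Y1 p.1, outsourced p)) @^-1` G) =
  P2 ((fun w => (Y2 w, T2 w)) @^-1` G).
Proof.
pose PM : probability _ R := M.
apply: (eq_preimage_measure _ _ (measurable_prod_measurableType E (\bar R))).
- apply: measurable_fun_pair; last exact: measurable_outsourced.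
  by apply: measurableT_comp => //; exact: measurable_fst.
- exact: measurable_fun_pair.
- move=> _ _ [C1 mC1 [D1 mD1 <-]] [C2 mC2 [D2 mD2 <-]].
  exists (C1 `&` C2); first exact: measurableI.
  by exists (D1 `&` D2); [exact: measurableI|rewrite setXI].
- exact: etrans (probability_setT PM) (esym (probability_setT P2)).
- by rewrite (le_lt_trans (probability_le1 PM measurableT)) ?ltry.
- move=> _ [C mC [D mD <-]]; apply: etrans (outsourced_rectangle mC mD).
  congr (M _).
  by apply/seteqP; split => p /= [] // [].
Qed.

End outsourcing.

(** * Dependence of transport costs and expectations on laws only *)

Section law_invariance.
Context {R : realType} {E : ptopologicalType}.
Implicit Types (X Y : rvar R E) (c : E -> E -> R) (g : E -> R).

Lemma same_law_sym X Y : same_law X Y -> same_law Y X.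
Proof. by move=> XY A mA; rewrite XY. Qed.

Lemma same_law_trans X Y Z : same_law X Y -> same_law Y Z -> same_law X Z.
Proof. by move=> XY YZ A mA; rewrite XY// YZ. Qed.

Lemma eq_OT c X X' Y Y' : same_law X X' -> same_law Y Y' ->
  OT c X Y = OT c X' Y'.
Proof.
move=> XX' YY'; congr ereal_inf; apply/seteqP; split => t.
  move=> [d [W [P [U [V [UX VY ->]]]]]]; exists d, W, P, U, V.
  by split=> //; [exact: same_law_trans UX _|exact: same_law_trans VY _].
move=> [d [W [P [U [V [UX VY ->]]]]]]; exists d, W, P, U, V.
by split=> //; [exact: same_law_trans UX (same_law_sym XX')|
  exact: same_law_trans VY (same_law_sym YY')].
Qed.

Lemma OT_ge0 c X Y : (forall x y, 0 <= c x y) -> (0 <= OT c X Y)%E.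
Proof.
move=> c0; apply: le_ereal_inf_tmp => _ [d [W [P [U [V [_ _ ->]]]]]].
exact: expectation_ge0.
Qed.

Section expect_measurable.
Variable g : E -> R.
Hypothesis mg : measurable_fun [set: borel E] (g : borel E -> R).

Lemma eq_expect X Y :
  (rv_prob X).-integrable setT (EFin \o (g \o rv_map X)) ->
  (rv_prob Y).-integrable setT (EFin \o (g \o rv_map Y)) ->
  same_law X Y -> expect g X = expect g Y.
Proof.
move=> iX iY XY; rewrite /expect unlock.
have mEg : measurable_fun [set: borel E] (EFin \o (g : borel E -> R)).
  exact/measurable_EFinP.
rewrite -[LHS](integral_distribution mEg iX).
rewrite -[RHS](integral_distribution mEg iY).
by apply: eq_measure_integral => A mA _; exact: XY.
Qed.

(** The integrand defining [Lcg] dominates the absolute value of [g]. *)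
Lemma Lcg_integrable c X : (forall x y, 0 <= c x y) ->
    (forall x, measurable_fun [set: borel E] (c x : borel E -> R)) ->
    (forall x, measurable_fun [set: borel E] (c^~ x : borel E -> R)) ->
  Lcg c g X -> (rv_prob X).-integrable setT (EFin \o (g \o rv_map X)).
Proof.
move=> c0 mc1 mc2 [x0]; rewrite /expect unlock => fin.
have mX := @measurable_funPT _ _ _ _ (rv_map X).
have mgX : measurable_fun setT (g \o rv_map X) by exact: (measurableT_comp mg).
apply/integrableP; split; first exact/measurable_EFinP.
apply: le_lt_trans fin; apply: ge0_le_integral => //=.
- exact/measurable_EFinP/measurableT_comp.
- apply/measurable_EFinP/measurable_funD.
    apply: measurable_funD.
      exact: (measurableT_comp (mc2 x0)).
    exact: (measurableT_comp (mc1 x0)).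
  exact: measurableT_comp.
- by move=> w _; rewrite lee_fin lerDr addr_ge0.
Qed.

End expect_measurable.
End law_invariance.

(** * The triangle inequality for transport costs, by gluing couplings *)

Lemma measurable_mfun (d d' : measure_display) (T : measurableType d)
    (U : measurableType d') (f : T -> U) : measurable_fun setT f ->
  exists F : {mfun T >-> U}, F = f :> (T -> U).
Proof. by move=> mf; exists (mfun_Sub (mem_set mf)). Qed.

Lemma OT_triangle (R : realType) (E : ptopologicalType) (c : E -> E -> R)
    (encode : borel E -> \bar R) (decode : \bar R -> borel E) :
    quasi_pseudo_metric c ->
    measurable_fun [set: borel E * borel E] (fun p => c p.1 p.2) ->
    measurable_fun setT encode -> measurable_fun setT decode ->
    cancel encode decode ->
  forall X Y Z : rvar R E, (OT c X Z <= OT c X Y + OT c Y Z)%E.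
Proof.
move=> [c0 _ c_tri] mc mencode mdecode encodeK X Y Z.
have OT0 U V : (0 <= OT c U V)%E by exact: OT_ge0.
(* Almost optimal couplings reduce the claim to gluing two given ones; an infinite cost on the right
   is trivial. *)
suff glue a b :
    [set t | exists (d : measure_display) (W : measurableType d)
      (P : probability W R) (X' Y' : {RV P >-> borel E}),
      [/\ same_law (Rvar X') X, same_law (Rvar Y') Y &
        t = 'E_P[fun w => c (X' w) (Y' w)]%E]] a ->
    [set t | exists (d : measure_display) (W : measurableType d)
      (P : probability W R) (X' Y' : {RV P >-> borel E}),
      [/\ same_law (Rvar X') Y, same_law (Rvar Y') Z &
        t = 'E_P[fun w => c (X' w) (Y' w)]%E]] b -> (OT c X Z <= a + b)%E.
  have [finXY|] := boolP (OT c X Y \is a fin_num); last first.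
    rewrite ge0_fin_numE// -leNgt leye_eq => /eqP ->.
    by rewrite addye ?leey// gt_eqF// (lt_le_trans _ (OT0 _ _)).
  have [finYZ|] := boolP (OT c Y Z \is a fin_num); last first.
    rewrite ge0_fin_numE// -leNgt leye_eq => /eqP ->.
    by rewrite addey ?leey// gt_eqF// (lt_le_trans _ (OT0 _ _)).
  apply/lee_addgt0Pr => e e0; have e20 : 0 < e / 2 by rewrite divr_gt0.
  have [a Sa ale] := lb_ereal_inf_adherent e20 finXY.
  have [b Sb ble] := lb_ereal_inf_adherent e20 finYZ.
  apply: le_trans (glue _ _ Sa Sb) _.
  apply: le_trans (leeD (ltW ale) (ltW ble)) _.
  by rewrite [e in leRHS]splitr EFinD addeACA.
move=> [d1 [W1 [P1 [X1 [Y1 [XX1 YY1 ->]]]]]].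
move=> [d2 [W2 [P2 [Y2 [Z2 [YY2 ZZ2 ->]]]]]].
have mT2 : measurable_fun setT (encode \o Z2) by exact: measurableT_comp.
have Y12 A : measurable A -> P1 (Y1 @^-1` A) = P2 (Y2 @^-1` A).
  by move=> mA; apply: etrans (YY1 A mA) (esym (YY2 A mA)).
(* [T1] stands for the code of [Z2] on the enlarged space, and [decode \o T1] for [Z2] itself. *)
pose T1 := outsourced mT2 Y12.
have mT1 : measurable_fun setT T1 by exact: measurable_outsourced.
pose P : probability _ R := (P1 \x uniform_prob (@ltr01 R))%E.
have PT1 G : measurable G -> P ((fun p => (Y1 p.1, T1 p)) @^-1` G) =
  P2 ((fun w => (Y2 w, encode (Z2 w))) @^-1` G) by exact: outsourced_law.
have Pfst B : measurable B -> P (fst @^-1` B) = P1 B.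
  move=> mB; rewrite (_ : fst @^-1` B = B `*` setT); last first.
    by apply/seteqP; split => p //= [].
  rewrite /P /= product_measure1E// -[RHS]mule1.
  by congr (_ * _)%E; exact: probability_setT.
have mX1 : measurable_fun setT (fun p : W1 * measurableTypeR R => X1 p.1).
  by apply: measurableT_comp => //; exact: measurable_fst.
have mY1 : measurable_fun setT (fun p : W1 * measurableTypeR R => Y1 p.1).
  by apply: measurableT_comp => //; exact: measurable_fst.
have mZ1 : measurable_fun setT (decode \o T1) by exact: measurableT_comp.
have mcE dW (W : measurableType dW) (f : W -> borel E * borel E) :
  measurable_fun setT f ->
  measurable_fun setT (fun w => (c (f w).1 (f w).2)%:E).
  by move=> mf; apply/measurable_EFinP; exact: measurableT_comp mc mf.
have [X' X'E] := measurable_mfun mX1.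
have [Z' Z'E] := measurable_mfun mZ1.
apply: (@le_trans _ _ ('E_P[fun w => c (X' w) (Z' w)])%E).
  apply: ereal_inf_lbound; exists _, _, P, X', Z'; split => // A mA.
    rewrite -XX1// /distribution /pushforward /= X'E.
    by apply: (Pfst (X1 @^-1` A)); exact: measurable_funPTI.
  have mdA : measurable (decode @^-1` A).
    by rewrite -[X in measurable X]setTI; exact: mdecode.
  rewrite -ZZ2// /distribution /pushforward /= Z'E.
  (* The law of [decode \o T1] is read off the second marginal of the joint law, where [decode]
     cancels [encode]. *)
  transitivity (P ((fun p => (Y1 p.1, T1 p)) @^-1`
    (setT `*` (decode @^-1` A)))).
    by congr (P _); apply/seteqP; split => p //= [].
  rewrite PT1; last exact: measurableX.
  congr (P2 _); apply/seteqP; split => w /=.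
    by rewrite encodeK => -[].
  by rewrite encodeK.
rewrite X'E Z'E unlock.
have -> : (\int[P1]_w (c (X1 w) (Y1 w))%:E =
    \int[P]_p (c (X1 p.1) (Y1 p.1))%:E)%E.
  pose h w : \bar R := (c (X1 w) (Y1 w))%:E.
  apply/esym; apply: (@eq_preimage_integral _ _ _ _ _ _ _ P P1 fst id h) => //.
  - by apply: (mcE _ _ (fun w => (X1 w, Y1 w))); exact: measurable_fun_pair.
  - by move=> w; rewrite lee_fin.
(* The second cost depends only on the joint law of [Y2] and the code of [Z2], which [Y1] and [T1]
   share. *)
have -> : (\int[P2]_w (c (Y2 w) (Z2 w))%:E =
    \int[P]_p (c (Y1 p.1) (decode (T1 p)))%:E)%E.
  pose h (p : borel E * \bar R) : \bar R := (c p.1 (decode p.2))%:E.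
  transitivity (\int[P2]_w h (Y2 w, encode (Z2 w)))%E.
    by apply: eq_integral => w _; rewrite /h /= encodeK.
  apply/esym; apply: (@eq_preimage_integral _ _ _ _ _ _ _ P P2
    (fun p => (Y1 p.1, T1 p)) (fun w => (Y2 w, encode (Z2 w))) h) => //.
  - exact: measurable_fun_pair.
  - exact: measurable_fun_pair.
  - apply: (mcE _ _ (fun p : borel E * \bar R => (p.1, decode p.2))).
    apply: measurable_fun_pair; first exact: measurable_fst.
    by apply: measurableT_comp => //; exact: measurable_snd.
  - by move=> p; rewrite lee_fin.
(* Both costs now live on one space, where the triangle inequality through [Y1] holds pointwise. *)
rewrite -ge0_integralD//.
- apply: ge0_le_integral => //.
  + by move=> p _; rewrite lee_fin.
  + exact: mcE (measurable_fun_pair mX1 mZ1).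
  + apply: emeasurable_funD.
      exact: mcE (measurable_fun_pair mX1 mY1).
    exact: mcE (measurable_fun_pair mY1 mZ1).
  + by move=> p _; rewrite -EFinD lee_fin.
- by move=> p _; rewrite lee_fin.
- exact: mcE (measurable_fun_pair mX1 mY1).
- by move=> p _; rewrite lee_fin.
- exact: mcE (measurable_fun_pair mY1 mZ1).
Qed.

(** * From the triangle inequality to the partial order *)

Lemma ratio_le_iff (R : realFieldType) (gamma D a : R) :
    0 <= gamma -> 0 <= D -> 0 <= a ->
  (a / (D + a) <= gamma) = ((1 - gamma) * a <= gamma * D).
Proof.
move=> gamma0 D0 a0; have [a_gt0|] := ltP 0 a; last first.
  (* Here the denominator may vanish; with the convention 0/0 = 0 both inequalities hold. *)
  move=> ale0; have -> : a = 0 by apply/eqP; rewrite eq_le ale0.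
  by rewrite mul0r mulr0 gamma0 mulr_ge0.
rewrite ler_pdivrMr ?ltr_wpDl//; apply/idP/idP; lra.
Qed.

(** For antisymmetry, the two expectations coincide, so [1 - gamma > 0] forces both costs to vanish
    and the assumed metric identifies the laws. *)
Lemma le_gamma_partial_order_of_OT_triangle (R : realType)
    (E : ptopologicalType) (c : E -> E -> R) (g : E -> R) (gamma : R) :
    (forall x y, 0 <= c x y) ->
    (forall X, Lcg c g X ->
      (rv_prob X).-integrable setT (EFin \o (g \o rv_map X))) ->
    measurable_fun [set: borel E] (g : borel E -> R) ->
    (forall X Y Z : rvar R E, (OT c X Z <= OT c X Y + OT c Y Z)%E) ->
    metric_modulo (Lcg c g) same_law
      (fun X Y : rvar R E => (OT c X Y + OT c Y X)%E) ->
    0 <= gamma -> gamma < 1 ->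
  partial_order_modulo (Lcg c g) same_law
    (fun X Y : rvar R E => le_gamma c g gamma X Y).
Proof.
move=> c0 ig mg tri [fin sep _ _] gamma0 gamma1.
have OT0 X Y : (0 <= OT c X Y)%E by exact: OT_ge0.
have finOT X Y : Lcg c g X -> Lcg c g Y -> OT c X Y \is a fin_num.
  move=> LX LY; rewrite ge0_fin_numE//.
  by have /andP[_] := fin X Y LX LY; apply: le_lt_trans; rewrite leeDl.
have finE X : Lcg c g X -> expect g X \is a fin_num.
  by move=> LX; rewrite /expect unlock; apply: integrable_fin_num => //;
    exact: ig.
have OTxx X : Lcg c g X -> OT c X X = 0%E.
  move=> LX; have /(sep X X LX LX) : same_law X X by [].
  by move/eqP; rewrite padde_eq0// => /andP[/eqP].
have leE X Y : Lcg c g X -> Lcg c g Y ->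
    le_gamma c g gamma X Y <->
    (fine (expect g X) <= fine (expect g Y)) /\
    (1 - gamma) * fine (OT c X Y) <=
      gamma * (fine (expect g Y) - fine (expect g X)).
  move=> LX LY; rewrite /le_gamma /gamma_star.
  have -> : (expect g X <= expect g Y)%E =
      (fine (expect g X) <= fine (expect g Y)).
    by rewrite -lee_fin !fineK ?finE.
  by split=> -[XY]; rewrite ratio_le_iff ?subr_ge0 ?fine_ge0.
split.
- move=> X X' Y Y' LX LX' LY LY' XX' YY'; rewrite /le_gamma /gamma_star.
  rewrite (eq_OT c XX' YY') (eq_expect mg (ig _ LX) (ig _ LX') XX').
  by rewrite (eq_expect mg (ig _ LY) (ig _ LY') YY').
- move=> X LX; apply/leE => //; split => //.
  by rewrite OTxx// mulr0 subrr mulr0.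
- move=> X Y Z LX LY LZ /(leE _ _ LX LY)[XY cXY] /(leE _ _ LY LZ)[YZ cYZ].
  apply/leE => //; split; first exact: le_trans XY YZ.
  have : fine (OT c X Z) <= fine (OT c X Y) + fine (OT c Y Z).
    by rewrite -fineD ?finOT// fine_le ?fin_numD ?finOT//.
  move=> t; have : (1 - gamma) * fine (OT c X Z) <=
      (1 - gamma) * (fine (OT c X Y) + fine (OT c Y Z)).
    by apply: ler_wpM2l => //; lra.
  lra.
- move=> X Y LX LY /(leE _ _ LX LY)[XY cXY] /(leE _ _ LY LX)[YX cYX].
  have EXY : fine (expect g X) = fine (expect g Y).
    by apply/eqP; rewrite eq_le XY.
  have OTeq0 U V : Lcg c g U -> Lcg c g V ->
      (1 - gamma) * fine (OT c U V) <= 0 -> OT c U V = 0%E.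
    move=> LU LV; rewrite pmulr_rle0 ?subr_gt0// => OTle.
    rewrite -(fineK (finOT _ _ LU LV)); congr EFin; apply/eqP.
    by rewrite eq_le OTle fine_ge0.
  rewrite EXY subrr mulr0 in cXY; rewrite EXY subrr mulr0 in cYX.
  apply/(sep _ _ LX LY).
  by rewrite (OTeq0 _ _ LX LY cXY) (OTeq0 _ _ LY LX cYX) adde0.
Qed.

(** * The order for a lower semicontinuous cost on a Polish space *)

Theorem theorem3p3 (R : realType) (E : ptopologicalType)
    (polishE : @polish_space R E)
    (c : E -> E -> R)
    (c_qpm : quasi_pseudo_metric c)
    (c_lsc : lower_semicontinuous (fun p : E * E => (c p.1 p.2)%:E))
    (g : E -> R)
    (g_borel : measurable_fun [set: borel E] (g : borel E -> R))
    (OT_metric : metric_modulo (Lcg c g) same_law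
                   (fun X Y : rvar R E => (OT c X Y + OT c Y X)%E))
    (gamma : R) (gamma_ge0 : 0 <= gamma) (gamma_lt1 : gamma < 1) :
  partial_order_modulo (Lcg c g) same_law
    (fun X Y : rvar R E => le_gamma c g gamma X Y).
Proof.
have [sepE [d [[d_ge0 d_eq0 d_sym d_tri] [d_nbhs d_complete]]]] := polishE.
have d_refl x : d x x = 0 by exact/d_eq0.
have [q q_dense] := polish_dense_sequence d_nbhs d_ge0 d_refl d_tri sepE.
(* Lower semicontinuity makes each set [c > a] open in the product, and separability puts open sets
   into the product of the Borel sigma-algebras. *)
have mc : measurable_fun [set: borel E * borel E] (fun p => c p.1 p.2).
  apply: (measurability _ (RGenOInfty.measurableE R)) => _ [_ [a ->] <-].
  rewrite setTI; apply: (measurable_open_prod d_sym d_tri d_nbhs q_dense).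
  rewrite (_ : _ @^-1` _ = [set p : E * E | (a%:E < (c p.1 p.2)%:E)%E]).
    exact: ((lower_semicontinuousP _).1 c_lsc a).
  by apply/seteqP; split => p /=; rewrite in_itv/= andbT lte_fin.
have c_ge0 x y : 0 <= c x y by case: c_qpm.
apply: le_gamma_partial_order_of_OT_triangle => // [X LX|].
  apply: (Lcg_integrable g_borel c_ge0 _ _ LX) => x.
    exact: (measurableT_comp mc (pair1_measurable (x : borel E))).
  exact: (measurableT_comp mc (pair2_measurable (x : borel E))).
have mencode := @measurable_encode _ _ _ q d_sym d_tri d_nbhs.
have mdecode := @measurable_decode _ _ _ q d_eq0 d_sym d_tri d_nbhs d_complete.
apply: (OT_triangle c_qpm mc mencode mdecode).
exact: encodeK.
Qed.
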